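(* Let $R$ be a commutative finite chain ring of nilpotency index $e$ and residue field $\mathbb{F}_q$, and let $n$ be a positive integer. Then \[d_n(R,a)=d_n(R,1)=(q-1)^{n-1}q^{(e-1)(n-1)}\] for all $a\in U(R)$.
   Context: A commutative finite chain ring (CFCR) is a finite commutative ring $R$ with identity $1\neq 0$ whose ideals are linearly ordered by inclusion. Its unique maximal ideal is principal; for a generator $\gamma$ of it, the nilpotency index of $R$ is the smallest positive integer $e$ with $\gamma^e=0$, and the residue field is $R/\gamma R\cong\mathbb{F}_q$ for a prime power $q$. $U(R)$ denotes the set of units of $R$. For a commutative ring $S$, $n\in\mathbb{N}$ and $a\in S$, $d_n(S,a)$ denotes the number of $n\times n$ diagonal matrices over $S$ with determinant $a$. *)

(* Defs.v *)
From HB Require Import structures.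
From mathcomp Require Import all_boot all_order all_fingroup all_algebra.
From mathcomp Require Import generic_quotient ring_quotient.

Set Implicit Arguments.
Unset Strict Implicit.
Unset Printing Implicit Defensive.

Import GRing.Theory.
Local Open Scope ring_scope.

Section Ideals.

Variable R : finComNzRingType.
Implicit Types (I J M : {set R}) (g : R).

(* Unlike [idealr_closed] of ring_quotient, the unit ideal is allowed. *)
Definition is_ideal I : Prop :=
  [/\ 0 \in I,
      {in I &, forall x y, x + y \in I} &
      forall a, {in I, forall x, a * x \in I}].

Definition maximal_ideal M : Prop :=
  [/\ is_ideal M, M <> setT &
      forall J, is_ideal J -> M \subset J -> J = M \/ J = setT].

Definition principal_ideal g : {set R} := [set g * x | x : R].

End Ideals.

Definition chain_ring (R : finComNzRingType) : Prop :=
  forall I J : {set R}, is_ideal I -> is_ideal J -> I \subset J \/ J \subset I.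

Definition nilpotency_index (R : finComNzRingType) (e : nat) : Prop :=
  exists2 g : R, maximal_ideal (principal_ideal g) &
    [/\ (0 < e)%N, g ^+ e = 0 &
        forall k : nat, (0 < k)%N -> g ^+ k = 0 -> (e <= k)%N].

(* The quotient ring is the one of ring_quotient, which is taken along a proper
   ideal bundled as a predicate [m : idealr R]; here [m] is the ideal g R. *)
Definition residue_field (R : finComNzRingType) (F : finFieldType) : Prop :=
  exists (g : R) (m : idealr R),
    [/\ maximal_ideal (principal_ideal g),
        m =i principal_ideal g &
        exists f : {rmorphism {ideal_quot m} -> F}, bijective f].

Definition diag_det_count (S : finComNzRingType) (n : nat) (a : S) : nat :=
  #|[set A : 'M[S]_n | is_diag_mx A && (\det A == a)]|.

(* Main.v *)
(* Let M = gR be the maximal ideal.  Elements outside M are units, so for k < e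
   the annihilator of g^k lies in M; comparing the map x |-> g^k x on R and on
   M gives [g^k R : g^(k+1) R] = [R : M] = q, hence |R| = q^e, |M| = q^(e-1) and
   |U(R)| = (q-1) q^(e-1).  A diagonal matrix with determinant the unit a has
   unit entries, and all of them but one may be chosen freely. *)
Require Import Defs.
From HB Require Import structures.
From mathcomp Require Import all_boot all_order all_fingroup all_algebra.
From mathcomp Require Import generic_quotient ring_quotient.

Set Implicit Arguments.
Unset Strict Implicit.
Unset Printing Implicit Defensive.

Import GRing.Theory.
Local Open Scope ring_scope.

(** The fibres of [f] are the cosets [K + x], and a set stable under translation by [K] contains
    every coset it meets. Additivity of [f] enters only through [fK]. *)
Lemma card_imset_fibre (U : finZmodType) (T : finType) (f : U -> T)
    (K A : {set U}) :
    (forall x y, (f x == f y) = (x - y \in K)) ->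
    {in K & A, forall k x, k + x \in A} ->
  #|A| = (#|f @: A| * #|K|)%N.
Proof.
move=> fK KA; rewrite -sum1_card (partition_big_imset f) /=.
rewrite -sum_nat_const; apply: eq_bigr => _ /imsetP[x Ax ->].
rewrite -(card_imset (mem K) (addIr x)) -sum1_card; apply: eq_bigl => y.
rewrite fK; apply/andP/imsetP => [[_ Kyx]|[k Kk ->]].
  by exists (y - x); rewrite ?subrK.
by rewrite addrK KA.
Qed.

Section PrincipalIdeals.

Variable R : finComNzRingType.
Implicit Types (g x : R) (M N : {set R}).

Lemma mem_principal_ideal g x : g * x \in principal_ideal g.
Proof. exact: imset_f. Qed.

Lemma principal_ideal_is_ideal g : is_ideal (principal_ideal g).
Proof.
split=> [|_ _ /imsetP[x _ ->] /imsetP[y _ ->]|a _ /imsetP[x _ ->]].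
- by rewrite -(mulr0 g) mem_principal_ideal.
- by rewrite -mulrDr mem_principal_ideal.
- by rewrite mulrCA mem_principal_ideal.
Qed.

(** The nilpotency index and the residue field each come with their own generator; this identifies
    the two ideals. *)
Lemma maximal_ideal_uniq M N :
  chain_ring R -> maximal_ideal M -> maximal_ideal N -> M = N.
Proof.
move=> chR [idM MT maxM] [idN NT maxN].
have [MN|NM] := chR _ _ idM idN; first by have [] := maxM N idN MN.
by have [] := maxN M idM NM.
Qed.

(** Multiplication by [g ^+ k] has the same kernel [K] on R as on gR, since [K] lies in gR. Counting
    both domains by fibres and cross-multiplying eliminates the order of [K]. *)
Lemma card_principal_ideal_expS g k :
    (forall x, g ^+ k * x = 0 -> x \in principal_ideal g) ->
  (#|R| * #|principal_ideal (g ^+ k.+1)| =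
   #|principal_ideal g| * #|principal_ideal (g ^+ k)|)%N.
Proof.
move=> ann_sub; pose K := [set x | g ^+ k * x == 0].
have fK x y : (g ^+ k * x == g ^+ k * y) = (x - y \in K).
  by rewrite inE mulrBr subr_eq0.
have [_ addM _] := principal_ideal_is_ideal g.
rewrite -cardsT (card_imset_fibre (A := setT) fK) => [|? ? _ _]; last first.
  by rewrite inE.
rewrite (card_imset_fibre (A := principal_ideal g) fK) => [|z x]; last first.
  by rewrite inE => /eqP/ann_sub Mz Mx; apply: addM.
have -> : [set g ^+ k * x | x in [set: R]] = principal_ideal (g ^+ k).
  by apply/setP => y; apply/imsetP/imsetP=> -[x _ ->]; exists x.
have -> : [set g ^+ k * x | x in principal_ideal g] =
          principal_ideal (g ^+ k.+1).
  by rewrite /principal_ideal -imset_comp; apply: eq_imset => x /=;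
     rewrite exprSr mulrA.
by rewrite [LHS]mulnC mulnA [RHS]mulnAC.
Qed.

Lemma card_residue_field (g : R) (F : finFieldType) :
    chain_ring R -> maximal_ideal (principal_ideal g) -> residue_field R F ->
  #|R| = (#|F| * #|principal_ideal g|)%N.
Proof.
move=> chR maxg [h [m [maxh mE [f [f' fK f'K]]]]].
rewrite (maximal_ideal_uniq chR maxg maxh).
pose p (x : R) := f (\pi_({ideal_quot m}) x)%qT.
have pK x y : (p x == p y) = (x - y \in principal_ideal h).
  by rewrite -mE Quotient.idealrBE (can_eq fK).
rewrite -cardsT (card_imset_fibre (A := setT) pK) => [|? ? _ _]; last first.
  by rewrite inE.
congr (_ * _)%N; rewrite -cardsT; congr #|pred_of_set _|; apply/setP => y.
(* Surjectivity of [p]: lift the preimage of [y] under [f] to a representative in R. *)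
rewrite inE; apply/imsetP; exists (repr (f' y)); rewrite // /p reprK.
by rewrite f'K.
Qed.

End PrincipalIdeals.

Section Units.

Variable R : finComUnitRingType.

(** The ideal xR is comparable with M = gR. If it contains M, maximality makes it M or R, and in the
    latter case 1 is a multiple of [x]. *)
Lemma mem_maximal_principal_ideal (g x : R) :
    chain_ring R -> maximal_ideal (principal_ideal g) ->
  (x \in principal_ideal g) = (x \isn't a GRing.unit).
Proof.
move=> chR [idM MT maxM].
have full (h : R) : h \is a GRing.unit -> principal_ideal h = setT.
  move=> Uh; apply/setP => y.
  by rewrite inE -(mulVKr Uh y) mem_principal_ideal.
have idx := principal_ideal_is_ideal x; have [_ _ mulM] := idM.
apply/idP/idP => [Mx | nUx].
  apply/negP => Ux; apply: MT; apply/setP => y.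
  by rewrite inE -(mulVKr Ux y) mulrC mulM.
have x_x : x \in principal_ideal x by rewrite -{1}[x]mulr1 mem_principal_ideal.
have [/maxM[//||xT]|/subsetP] := chR _ _ idM idx; [by move=> <- | | exact].
case/negP: nUx; have: 1 \in principal_ideal x by rewrite xT inE.
by case/imsetP => y _ xy1; apply/unitrP; exists y; rewrite mulrC -xy1.
Qed.

Lemma card_units_chain_ring (e : nat) (F : finFieldType) :
    chain_ring R -> nilpotency_index R e -> residue_field R F ->
  #|[pred x : R | x \is a GRing.unit]| = ((#|F| - 1) * #|F| ^ (e - 1))%N.
Proof.
move=> chR [g maxg [e_gt0 ge0 e_min]] resF.
have cR := card_residue_field chR maxg resF.
have F_gt0 : (0 < #|F|)%N by apply/card_gt0P; exists 0.
have M_gt0 : (0 < #|principal_ideal g|)%N.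
  by apply/card_gt0P; exists (g * 0); apply: mem_principal_ideal.
have cgk k : (k <= e)%N -> #|R| = (#|principal_ideal (g ^+ k)| * #|F| ^ k)%N.
  elim: k => [_|k IHk lt_ke].
    rewrite muln1 -cardsT; congr #|pred_of_set _|; apply/setP => x.
    by rewrite inE -[x]mul1r mem_principal_ideal.
  rewrite (IHk (ltnW lt_ke)) expnS mulnA; congr (_ * _)%N; apply/eqP.
  rewrite -(eqn_pmul2l M_gt0) -card_principal_ideal_expS => [|x gkx0].
    by rewrite cR -mulnA mulnC mulnA.
  (* A unit killed by [g ^+ k] would force [g ^+ k = 0] with [k < e]. Minimality of [e] excludes
     this only for positive [k]; for [k = 0] it would say 1 = 0. *)
  rewrite mem_maximal_principal_ideal //; apply/negP => Ux.
  have gk0 : g ^+ k = 0 by rewrite -(mulrK Ux (g ^+ k)) gkx0 mul0r.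
  case: k lt_ke gk0 {IHk gkx0} => [_ /eqP|k lt_ke gk0].
    by rewrite expr0 oner_eq0.
  by have := e_min k.+1 isT gk0; rewrite leqNgt lt_ke.
(* At [k = e] the ideal is zero, so R has [#|F| ^ e] elements; cancel one factor [#|F|]. *)
have cM : #|principal_ideal g| = (#|F| ^ (e - 1))%N.
  apply/eqP; rewrite -(eqn_pmul2l F_gt0) -cR -expnS subn1 prednK //.
  rewrite (cgk e) // ge0 -[X in _ == X]mul1n; apply/eqP; congr (_ * _)%N.
  rewrite -(cards1 (0 : R)); congr #|pred_of_set _|; apply/setP => x.
  rewrite inE; apply/imsetP/eqP => [[y _ ->]|->]; first by rewrite mul0r.
  by exists 0; rewrite ?mul0r.
rewrite -cM mulnBl mul1n -cR -(cardC (principal_ideal g)) addKn.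
apply: eq_card => x.
by rewrite !inE mem_maximal_principal_ideal // negbK.
Qed.

Lemma card_diag_det_unit (m : nat) (a : R) : a \is a GRing.unit ->
  diag_det_count m.+1 a = (#|[pred x : R | x \is a GRing.unit]| ^ m)%N.
Proof.
move=> Ua; set U := [pred x : R | _].
(* The entries after the first are free units; the first is then forced to be [a] divided by their
   product. *)
pose h (u : {ffun 'I_m -> R}) : 'M[R]_m.+1 :=
  diag_mx (\row_i if unlift ord0 i is Some j then u j else a / \prod_j u j).
have h_lift (u : {ffun 'I_m -> R}) j : h u (lift ord0 j) (lift ord0 j) = u j.
  by rewrite !mxE eqxx liftK.
have -> : (#|U| ^ m = #|@ffun_on 'I_m U|)%N.
  by rewrite card_ffun_on card_ord.
rewrite -(card_in_imset (f := h)) => [|u v _ _ huv]; last first.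
  by apply/ffunP => j; rewrite -!h_lift huv.
congr #|pred_of_set _|; apply/setP => A; rewrite inE.
apply/andP/imsetP => [[/diag_mxP[d ->]]|[u /ffun_onP Uu ->]]; last first.
  split; first exact: diag_mx_is_diag.
  rewrite det_diag big_ord_recl mxE unlift_none.
  rewrite [X in _ * X](eq_bigr u) => [|j _]; last by rewrite mxE liftK.
  by rewrite divrK //; apply: unitr_prod => i _; apply: Uu.
rewrite det_diag => /eqP detA.
(* In a commutative ring, each factor of a product that is a unit is itself a unit. *)
have Ud i : d 0 i \is a GRing.unit.
  by move: Ua; rewrite -detA => /unitr_prodP; apply; rewrite ?mem_index_enum.
exists [ffun j => d 0 (lift ord0 j)].
  by apply/ffun_onP => j; rewrite ffunE; apply: Ud.
congr diag_mx; apply/rowP => i; rewrite mxE.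
case: unliftP => [j ->|->]; first by rewrite ffunE.
under eq_bigr => j _ do rewrite ffunE.
rewrite -detA big_ord_recl mulrK //.
by apply: unitr_prod => j _; apply: Ud.
Qed.

End Units.

Theorem corollary3p4 (R : finComUnitRingType) (e q n : nat) (F : finFieldType)
    (hR : chain_ring R) (he : nilpotency_index R e)
    (hF : residue_field R F) (hq : #|F| = q) (hn : (0 < n)%N) :
  forall a : R, (a \is a GRing.unit)%R ->
    diag_det_count n a = diag_det_count n (1%R : R) /\
    diag_det_count n (1%R : R) = ((q - 1) ^ (n - 1) * q ^ ((e - 1) * (n - 1)))%N.
Proof.
case: n hn => // m _ a Ua.
rewrite (card_diag_det_unit m Ua) card_diag_det_unit ?unitr1 //; split=> //.
by rewrite (card_units_chain_ring hR he hF) hq subSS subn0 expnMn expnM.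
Qed.
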